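(* Let $m>2$ and let $x_{m+1}=u(x_1,\dots,x_m)$ be an entire minimal graph over $\mathbb{R}^m$, where $u:\mathbb{R}^m\to\mathbb{R}$ is smooth and $x=(x_1,\dots,x_m)$ are the standard Euclidean coordinates. If there exists a constant $c\in\mathbb{R}$ such that $$\lim_{R\to\infty}\ \max_{|x|=R}\left\{\frac{(u(x)-c)^2}{\sqrt{1+|du(x)|^2}}\right\}=0,$$ then the graph is a horizontal hyperplane (i.e. $u$ is constant).
   Context: An entire minimal graph is a graph $\{(x,u(x)):x\in\mathbb{R}^m\}\subset\mathbb{R}^{m+1}$ which is a minimal hypersurface, i.e. $u$ satisfies $\mathrm{div}\big(\frac{\nabla u}{\sqrt{1+|\nabla u|^2}}\big)=0$ on $\mathbb{R}^m$. $|du|$ is the Euclidean norm of the differential of $u$. *)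

(* Defs.v *)
From HB Require Import structures.
From mathcomp Require Import all_boot all_order all_algebra.
From mathcomp Require Import all_classical all_reals all_analysis.

Set Implicit Arguments.
Unset Strict Implicit.
Unset Printing Implicit Defensive.

Import Order.TTheory GRing.Theory Num.Theory.
Import numFieldNormedType.Exports.

Local Open Scope classical_set_scope.
Local Open Scope ring_scope.

(* The canonical norm [`|x|] on ['rV[R]_m] is the sup norm, so the Euclidean
   norm needs a definition of its own; both induce the same topology. *)
Definition enorm (R : realType) (m : nat) (x : 'rV[R]_m) : R :=
  Num.sqrt (\sum_(i < m) x ord0 i ^+ 2).

Definition partial (R : realType) (m : nat) (i : 'I_m) (f : 'rV[R]_m -> R)
    (x : 'rV[R]_m) : R :=
  'D_(delta_mx ord0 i) f x.

Definition iter_partial (R : realType) (m : nat) (s : seq 'I_m)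
    (f : 'rV[R]_m -> R) : 'rV[R]_m -> R :=
  foldr (@partial R m) f s.

(* [partial] is total, hence existence of each derivative is required
   separately from continuity. *)
Definition smooth (R : realType) (m : nat) (f : 'rV[R]_m -> R) : Prop :=
  forall s : seq 'I_m,
    continuous (iter_partial s f) /\
    forall (i : 'I_m) (x : 'rV[R]_m),
      derivable (iter_partial s f) x (delta_mx ord0 i).

Definition grad (R : realType) (m : nat) (f : 'rV[R]_m -> R)
    (x : 'rV[R]_m) : 'rV[R]_m :=
  \row_(i < m) partial i f x.

Definition divergence (R : realType) (m : nat) (F : 'rV[R]_m -> 'rV[R]_m)
    (x : 'rV[R]_m) : R :=
  \sum_(i < m) partial i (fun y => F y ord0 i) x.

(* sqrt (1 + |du|^2), the density of the volume element of the graph of [u] *)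
Definition area_density (R : realType) (m : nat) (u : 'rV[R]_m -> R)
    (x : 'rV[R]_m) : R :=
  Num.sqrt (1 + enorm (grad u x) ^+ 2).

Definition entire_minimal_graph (R : realType) (m : nat)
    (u : 'rV[R]_m -> R) : Prop :=
  forall x : 'rV[R]_m,
    divergence (fun y => (area_density u y)^-1 *: grad u y) x = 0.

(* For continuous [f] this supremum is a maximum, see [sphere_max_attained]. *)
Definition sphere_max (R : realType) (m : nat) (f : 'rV[R]_m -> R) (r : R) : R :=
  sup [set f x | x in [set x | enorm x = r]].

Lemma continuous_enorm (R : realType) (m : nat) : continuous (@enorm R m).
Proof.
move=> x; apply: (@continuous_comp _ _ _
  (fun y : 'rV[R]_m => \sum_(i < m) y ord0 i ^+ 2) (@Num.sqrt R));
  last exact: sqrt_continuous.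
apply: (@cvg_big _ _ _ _ _ _ _ (nbhs x)) => [|i _].
  exact: add_continuous.
apply: (@continuous_comp _ _ _ (fun y : 'rV[R]_m => y ord0 i)
  (fun t : R => t ^+ 2)); first exact: coord_continuous.
exact: exprn_continuous.
Qed.

Lemma coord_le_enorm (R : realType) (m : nat) (x : 'rV[R]_m) (i : 'I_m) :
  `|x ord0 i| <= enorm x.
Proof.
rewrite -sqrtr_sqr ler_sqrt ?sumr_ge0// => [|j _]; last exact: sqr_ge0.
by rewrite (bigD1 i)//= lerDl sumr_ge0// => j _; exact: sqr_ge0.
Qed.

Lemma enorm_sphere_compact (R : realType) (m : nat) (r : R) :
  compact [set x : 'rV[R]_m | enorm x = r].
Proof.
apply: bounded_closed_compact.
  exists r; split; first exact: num_real.
  move=> M rM x /= xr; have M0 : 0 <= M.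
    by rewrite (le_trans _ (ltW rM))// -xr sqrtr_ge0.
  rewrite [leLHS]mx_normrE; apply/bigmax_leP; split=> //= -[i j] _ /=.
  by rewrite ord1 (le_trans (coord_le_enorm x j))// xr ltW.
apply: (@preimage_closed _ _ (@enorm R m) [set r]); last exact: closed_eq.
by move=> x _; exact: continuous_enorm.
Qed.

Lemma sphere_max_attained (R : realType) (m : nat) (f : 'rV[R]_m -> R) (r : R) :
  (0 < m)%N -> 0 <= r -> continuous f ->
  exists x : 'rV[R]_m, [/\ enorm x = r, sphere_max f r = f x &
    forall y : 'rV[R]_m, enorm y = r -> f y <= f x].
Proof.
case: m f => // m f _ r0 cf.
have Sr : [set x : 'rV[R]_m.+1 | enorm x = r] !=set0.
  exists (r *: delta_mx ord0 ord0); rewrite /= /enorm big_ord_recl big1 => [|i _].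
    by rewrite !mxE !eqxx mulr1 addr0 sqrtr_sqr ger0_norm.
  by rewrite !mxE /= mulr0 expr0n.
have [] := @EVT_max_rV _ _ f _ Sr (@enorm_sphere_compact R m.+1 r).
  exact: continuous_subspaceT.
move=> x /[!inE] xr xmax; exists x.
have fmax y : enorm y = r -> f y <= f x by move=> yr; apply: xmax; rewrite inE.
split=> //; apply/eqP; rewrite eq_le; apply/andP; split.
  by apply: ge_sup => [|_ [y /= yr <-]]; [exists (f x); exists x | exact: fmax].
apply: ub_le_sup; last by exists x.
by exists (f x) => _ [y /= yr <-]; exact: fmax.
Qed.

(* Main.v *)
(** The radial cutoffs are built from q = sqrt (1 + |x|^2), which is smooth and
    comparable to |x|. Write m = n + 2, W for the area density, v = u - c,
    F = grad u / W (divergence free by the minimal surface equation),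
    b = <x, grad u>, delta = Q^-n, p = q^-n, and eta = max (1 - delta q^n) 0,
    which is supported in {q <= Q}.

    Conservation of the stress-energy tensor (W - 1) Id - grad u (x) grad u / W,
    contracted with the radial field p eta^3 x, gives a field Y with
      n (W - 1) p eta^3 / q^2 <= div Y + 3 n delta eta^2 (W - 1),
    a differential form of the monotonicity of R^-n times the area excess of
    the ball of radius R. Testing the minimal surface equation against eta^2 v
    gives the Caccioppoli inequality
      eta^2 (W - 1) <= 2 div (eta^2 v F) + 4 n^2 Q^-2 v^2 / W.
    Hence n (W - 1) p eta^3 / q^2 <= div Z + 12 n^3 Q^-m v^2 / W with Z
    supported in {q <= Q}. The integral of the last term over the cube
    [-Q, Q]^m tends to 0 as Q tends to infinity, because v^2 / W tends to 0 at
    infinity, so W = 1 everywhere.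

    Integrals are replaced by sums over a lattice of mesh tending to 0: by
    discrete translation invariance the sum of a compactly supported partial
    derivative is negligible. *)

Require Import Defs.
From HB Require Import structures.
From mathcomp Require Import all_boot all_order all_algebra.
From mathcomp Require Import all_classical all_reals all_analysis.
From mathcomp Require Import ring lra.

Set Implicit Arguments.
Unset Strict Implicit.
Unset Printing Implicit Defensive.

Import Order.TTheory GRing.Theory Num.Theory.
Import numFieldNormedType.Exports.

Local Open Scope classical_set_scope.
Local Open Scope ring_scope.

(** * One-variable and directional derivatives *)

(** Both difference quotients are the same function of [h]. This transfers one-variable results such
    as the chain rule and the mean value theorem to directional derivatives. *)
Lemma is_derive_lineP (R : realType) (V : normedModType R) (f : V -> R)
    (x v : V) (t a : R) :
  is_derive (t *: v + x) v f a <->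
  is_derive t (1 : R) (fun s : R => f (s *: v + x)) a.
Proof.
have E : (fun h : R => h^-1 *: ((f \o shift (t *: v + x)) (h *: v) - f (t *: v + x)))
  = (fun h : R => h^-1 *: (((fun s : R => f (s *: v + x)) \o shift t) (h *: (1 : R)) -
       f (t *: v + x))).
  by apply/funext => h /=; rewrite addrA -scalerDl [h *: 1]mulr1.
by split=> -[dfx dfxE]; (apply: DeriveDef; [move: dfx; rewrite /derivable|
  move: dfxE; rewrite /derive]); rewrite E.
Qed.

Lemma is_derive_comp (R : realType) (V : normedModType R) (f : V -> R)
    (g : R -> R) (x v : V) (a b : R) :
  is_derive (f x) (1 : R) g b -> is_derive x v f a ->
  is_derive x v (fun y => g (f y)) (b * a).
Proof.
move=> dg df.
have /is_derive_lineP dfl : is_derive ((0 : R) *: v + x) v f a.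
  by rewrite scale0r add0r.
have dgl : is_derive (f ((0 : R) *: v + x)) (1 : R) g b.
  by rewrite scale0r add0r.
have := iffRL (is_derive_lineP (fun y => g (f y)) x v 0 (b * a))
  (is_derive1_comp dgl dfl).
by rewrite scale0r add0r.
Qed.

(** A quadratic remainder suffices for differentiability. This covers the squared positive part,
    which is not twice differentiable, and coordinates along a line, with [C = 0]. *)
Lemma is_derive_quadratic_bound (R : realType) (f : R -> R) (x l C : R) :
  (forall h, `|f (x + h) - f x - h * l| <= C * h ^+ 2) ->
  is_derive x (1 : R) f l.
Proof.
move=> fC; have C0 : 0 <= C.
  by have := fC 1; rewrite expr1n mulr1; apply: le_trans.
suff cf : h^-1 *: ((f \o shift x) (h *: (1:R)) - f x) @[h --> 0^'] --> l.
  by split; [apply/cvg_ex; exists l|apply/cvg_lim].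
apply/cvgrPdist_le => e e0; near=> h.
have h0 : h != 0 by near: h; exact: nbhs_dnbhs_neq.
have hd : `|h| <= e / (C + 1).
  by near: h; apply: dnbhs0_le; rewrite divr_gt0// ltr_wpDl.
rewrite /= [h *: 1]mulr1 (addrC h).
have -> : l - h^-1 *: (f (x + h) - f x) = - (h^-1 * (f (x + h) - f x - h * l)).
  have -> : h^-1 *: (f (x + h) - f x) = h^-1 * (f (x + h) - f x) by [].
  by move: (f _ - f _) => A; field.
rewrite normrN normrM normfV ler_pdivrMl ?normr_gt0//.
apply: le_trans (fC h) _; rewrite -real_normK ?num_real// expr2 mulrCA ler_wpM2l//.
apply: le_trans (_ : (C + 1) * `|h| <= _); first by rewrite ler_wpM2r// lerDl.
by rewrite mulrC -ler_pdivlMr// ltr_wpDl.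
Unshelve. all: by end_near. Qed.

Lemma is_derive_sqr_pos_part (R : realType) (x : R) :
  is_derive x (1 : R) (fun s => Num.max s 0 ^+ 2) (2 * Num.max x 0).
Proof.
apply: (@is_derive_quadratic_bound _ _ _ _ 1) => h.
rewrite mul1r ler_norml.
case: (leP x 0) => x0; case: (leP (x + h) 0) => xh0; nra.
Qed.

(** Only [x] is confined to [K]: the point [y] may leave it, as the forward translate of a boundary
    lattice node does. *)
Lemma compact_uniform (R : realType) (V : normedModType R) (K : set V)
    (f : V -> R) (e : R) :
  compact K -> continuous f -> 0 < e ->
  exists2 d, 0 < d & forall x y, K x -> `|y - x| < d -> `|f y - f x| <= e.
Proof.
move=> /compact_near_coveringP cK cf e0.
have := cK R (0^'+) (fun d x => forall y, `|y - x| < d -> `|f y - f x| <= e) _.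
case=> [x Kx|d /= d0 dK].
  have /cvgrPdist_le/(_ (e / 2)) := cf x.
  rewrite divr_gt0// => /(_ isT) /nbhs_normP[d /= d0 dx].
  near=> x' d' => y yd.
  have xx' : `|x - x'| < d / 2 by near: x'; apply: cvgr_dist_lt => //; rewrite divr_gt0.
  have dd : d' < d / 2.
    by near: d'; apply: nbhs_right_lt; rewrite divr_gt0.
  have h1 : `|f x - f y| <= e / 2.
    apply: dx => /=; rewrite -(subrKA x').
    apply: le_lt_trans (ler_normD _ _) _; rewrite (splitr d) ltrD//.
    by rewrite distrC (lt_trans yd).
  have h2 : `|f x - f x'| <= e / 2.
    by apply: dx => /=; rewrite (lt_trans xx')// ltr_pdivrMr// ltr_pMr// ltr1n.
  rewrite -(subrKA (f x)) (le_trans (ler_normD _ _))// (splitr e) lerD//.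
  by rewrite distrC.
exists (d / 2); first by rewrite divr_gt0.
move=> x y Kx xy.
apply: (dK (d / 2)) => //=; last by rewrite divr_gt0.
by rewrite sub0r normrN gtr0_norm ?divr_gt0// ltr_pdivrMr// ltr_pMr// ltr1n.
Unshelve. all: by end_near. Qed.

(** * Calculus of functions that are C^1 along a fixed direction *)

Section C1Along.
Variables (R : realType) (V : normedModType R) (v : V).
Implicit Types f g df dg : V -> R.

(* A single directional derivative does not control continuity of [f], which
   is therefore part of the definition. *)
Definition c1_along f df : Prop :=
  [/\ continuous f, continuous df & forall x, is_derive x v f (df x)].

Lemma c1_along_ext f df dg :
  (forall x, df x = dg x) -> c1_along f df -> c1_along f dg.
Proof. by move=> /funext ->. Qed.

Lemma c1_along_cst (a : R) : c1_along (fun=> a) (fun=> 0).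
Proof. by split=> [x|x|x]; [exact: cvg_cst|exact: cvg_cst|exact: is_derive_cst]. Qed.

Lemma c1_alongD f df g dg : c1_along f df -> c1_along g dg ->
  c1_along (fun x => f x + g x) (fun x => df x + dg x).
Proof.
move=> [cf cdf ddf] [cg cdg ddg]; split=> x.
- by apply: cvgD; [exact: cf|exact: cg].
- by apply: cvgD; [exact: cdf|exact: cdg].
- exact: (@is_deriveD _ _ _ f g).
Qed.

Lemma c1_alongN f df : c1_along f df ->
  c1_along (fun x => - f x) (fun x => - df x).
Proof.
move=> [cf cdf ddf]; split=> x.
- by apply: cvgN; exact: cf.
- by apply: cvgN; exact: cdf.
- exact: (@is_deriveN _ _ _ f).
Qed.

Lemma c1_alongB f df g dg : c1_along f df -> c1_along g dg ->
  c1_along (fun x => f x - g x) (fun x => df x - dg x).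
Proof. by move=> hf hg; apply: c1_alongD => //; exact: c1_alongN. Qed.

Lemma c1_alongM f df g dg : c1_along f df -> c1_along g dg ->
  c1_along (fun x => f x * g x) (fun x => df x * g x + f x * dg x).
Proof.
move=> [cf cdf ddf] [cg cdg ddg]; split=> x.
- by apply: cvgM; [exact: cf|exact: cg].
- apply: cvgD; apply: cvgM;
    by [exact: cdf|exact: cg|exact: cf|exact: cdg].
- apply: (@is_derive_eq _ _ _ _ _ _ _ _
    (@is_deriveM _ _ f g x v _ _ (ddf x) (ddg x))).
  by rewrite addrC [g x *: _]mulrC.
Qed.

Lemma c1_along_sum n (f df : 'I_n -> V -> R) :
  (forall i, c1_along (f i) (df i)) ->
  c1_along (fun x => \sum_(i < n) f i x) (fun x => \sum_(i < n) df i x).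
Proof.
elim: n f df => [|n IH] f df hf.
  have E (h : 'I_0 -> V -> R) : (fun x => \sum_(i < 0) h i x) = (fun=> 0).
    by apply/funext => x; rewrite big_ord0.
  by rewrite !E; exact: c1_along_cst.
have E (h : 'I_n.+1 -> V -> R) : (fun x => \sum_(i < n.+1) h i x) =
    (fun x => h ord0 x + \sum_(i < n) h (lift ord0 i) x).
  by apply/funext => x; rewrite big_ord_recl.
by rewrite !E; apply: c1_alongD; [exact: hf|apply: IH => i; exact: hf].
Qed.

Lemma c1_along_comp (h : R -> R) f df g : c1_along f df ->
  (forall x, is_derive (f x) (1 : R) h (g x)) -> continuous g ->
  c1_along (fun x => h (f x)) (fun x => g x * df x).
Proof.
move=> [cf cdf ddf] dh cg; split=> x.
- apply: (@continuous_comp _ _ _ f h); first exact: cf.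
  by apply/differentiable_continuous/derivable1_diffP; have [] := dh x.
- by apply: cvgM; [exact: cg|exact: cdf].
- exact: is_derive_comp.
Qed.

Lemma c1_alongV f df : (forall x, f x != 0) -> c1_along f df ->
  c1_along (fun x => (f x)^-1) (fun x => - (f x) ^- 2 * df x).
Proof.
move=> f0 hf; have [cf _ _] := hf.
apply: c1_along_comp hf _ _ => x.
  by apply: (@is_derive_eq _ _ _ _ _ _ _ _ (is_deriveV (f0 x) (is_derive_id _ _)));
    rewrite [_ *: _]mulr1.
apply: cvgN; apply: cvgV; first by rewrite expf_neq0.
by apply: (@continuous_comp _ _ _ f (fun s : R => s ^+ 2));
  [exact: cf|exact: exprn_continuous].
Qed.

Lemma c1_along_sqrt f df : (forall x, 0 < f x) -> c1_along f df ->
  c1_along (fun x => Num.sqrt (f x)) (fun x => (2 * Num.sqrt (f x))^-1 * df x).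
Proof.
move=> f0 hf; have [cf _ _] := hf.
apply: c1_along_comp hf _ _ => x; first exact: is_derive1_sqrt.
apply: cvgV; first by rewrite mulf_neq0// gt_eqF// sqrtr_gt0.
apply: cvgM; first exact: cvg_cst.
by apply: (@continuous_comp _ _ _ f Num.sqrt); [exact: cf|exact: sqrt_continuous].
Qed.

Lemma c1_alongX n f df : c1_along f df ->
  c1_along (fun x => f x ^+ n) (fun x => n%:R * f x ^+ n.-1 * df x).
Proof.
move=> hf; have [cf _ _] := hf.
apply: (c1_along_comp (h := fun s => s ^+ n) hf) => x.
  have -> : (fun s : R => s ^+ n) = id ^+ n by apply/funext => s; rewrite exprfctE.
  apply: (@is_derive_eq _ _ _ _ _ _ _ _
    (@is_deriveX _ _ id n (f x) 1 1 (is_derive_id _ _))).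
  by rewrite [_ *: _]mulr1.
apply: cvgM; first exact: cvg_cst.
by apply: (@continuous_comp _ _ _ f (fun s : R => s ^+ n.-1));
  [exact: cf|exact: exprn_continuous].
Qed.

Lemma c1_along_sqr_pos_part f df : c1_along f df ->
  c1_along (fun x => Num.max (f x) 0 ^+ 2) (fun x => 2 * Num.max (f x) 0 * df x).
Proof.
move=> hf; have [cf _ _] := hf.
apply: (c1_along_comp (h := fun s => Num.max s 0 ^+ 2) hf) => x.
  exact: is_derive_sqr_pos_part.
apply: cvgM; first exact: cvg_cst.
apply: (@continuous_max _ _ f (fun=> 0)); [exact: cf|exact: cvg_cst].
Qed.

Lemma c1_along_MVT f df (x : V) (h : R) : c1_along f df -> 0 < h ->
  exists2 s, 0 < s < h & f (h *: v + x) - f x = h * df (s *: v + x).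
Proof.
move=> [cf cdf ddf] h0.
have dline (t : R) : is_derive t (1 : R) (fun s : R => f (s *: v + x)) (df (t *: v + x)).
  exact: (iffLR (is_derive_lineP f x v t _)).
have [|s] := @MVT R (fun s : R => f (s *: v + x))
  (fun s => df (s *: v + x)) 0 h h0 (fun t _ => dline t).
  apply: continuous_subspaceT => t.
  by apply/differentiable_continuous/derivable1_diffP; have [] := dline t.
by rewrite in_itv /= scale0r add0r subr0 mulrC => sh ->; exists s.
Qed.

End C1Along.

Lemma c1_along_shift (R : realType) (V : normedModType R) (v a : V)
    (f df : V -> R) : c1_along v f df ->
  c1_along v (fun x => f (a + x)) (fun x => df (a + x)).
Proof.
move=> [cf cdf ddf].
have ca : continuous (fun x : V => a + x).
  by move=> x; apply: cvgD; [exact: cvg_cst|exact: cvg_id].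
split=> x.
- by apply: continuous_comp; [exact: ca|exact: cf].
- by apply: continuous_comp; [exact: ca|exact: cdf].
have -> : x = (0 : R) *: v + x by rewrite scale0r add0r.
apply: (iffRL (is_derive_lineP _ _ _ _ _)).
have -> : (fun s : R => f (a + (s *: v + x))) = (fun s : R => f (s *: v + (a + x))).
  by apply/funext => s; rewrite addrCA.
apply: (iffLR (is_derive_lineP _ _ _ _ _)).
by rewrite addrCA; exact: ddf.
Qed.

(** * Symmetry of mixed derivatives and constancy under zero gradient *)

Lemma c1_along_second_difference (R : realType) (V : normedModType R) (v w : V)
    (f fv fvw : V -> R) (x : V) (h : R) :
  c1_along v f fv -> c1_along w fv fvw -> 0 < h ->
  exists2 y, `|y - x| <= h * (`|v| + `|w|) &
    f (h *: w + (h *: v + x)) - f (h *: v + x) - (f (h *: w + x) - f x) =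
    h * (h * fvw y).
Proof.
move=> hv hw h0.
have hg := c1_alongB (c1_along_shift (h *: w) hv) hv.
have [s /andP[s0 sh] ->] := c1_along_MVT x hg h0.
have [t /andP[t0 th] ->] := c1_along_MVT (s *: v + x) hw h0.
exists (t *: w + (s *: v + x)) => //.
rewrite addrA addrK addrC (le_trans (ler_normD _ _))// !normrZ mulrDr lerD//.
  by rewrite gtr0_norm// ler_wpM2r// ltW.
by rewrite gtr0_norm// ler_wpM2r// ltW.
Qed.

(** Both orders of differentiation compute the same second difference, so [fvw] and [fwv] take a
    common value at two points arbitrarily close to [x]; continuity concludes. *)
Lemma c1_along_symmetry (R : realType) (V : normedModType R) (v w : V)
    (f fv fw fvw fwv : V -> R) (x : V) :
  c1_along v f fv -> c1_along w fv fvw ->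
  c1_along w f fw -> c1_along v fw fwv -> fvw x = fwv x.
Proof.
move=> hv hvw hw hwv; apply/eqP; rewrite -subr_eq0 -normr_le0.
apply/ler_addgt0Pl => e e0; rewrite addr0.
have [_ c1 _] := hvw; have [_ c2 _] := hwv.
have e20 : 0 < e / 2 by rewrite divr_gt0.
have /cvgrPdist_le/(_ _ e20)/nbhs_normP[d1 /= d10 H1] := c1 x.
have /cvgrPdist_le/(_ _ e20)/nbhs_normP[d2 /= d20 H2] := c2 x.
pose N := `|v| + `|w|; have N0 : 0 <= N by rewrite addr_ge0.
pose d := Num.min d1 d2; have d0 : 0 < d by rewrite lt_min d10.
pose h := d / (N + 1); have h0 : 0 < h by rewrite divr_gt0// ltr_wpDl.
have hN : h * N < d.
  by rewrite /h -mulrA gtr_pMr// mulrC ltr_pdivrMr ?ltr_wpDl// mul1r ltrDl.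
have [y y1 E1] := c1_along_second_difference x hv hvw h0.
have [z z1 E2] := c1_along_second_difference x hw hwv h0.
have yz : fvw y = fwv z.
  have hh : h * h != 0 by rewrite mulf_neq0// gt_eqF.
  apply: (mulfI hh); rewrite -[LHS]mulrA -[RHS]mulrA -E1 -E2 (addrCA (h *: v)).
  ring.
have Hy : `|fvw x - fvw y| <= e / 2.
  by apply: H1 => /=; rewrite distrC (le_lt_trans y1)// (lt_le_trans hN)// ge_min lexx.
have Hz : `|fwv x - fwv z| <= e / 2.
  apply: H2 => /=; rewrite distrC (le_lt_trans z1)// (addrC `|w|).
  by rewrite (lt_le_trans hN)// ge_min lexx orbT.
rewrite -(subrKA (fvw y)) (splitr e) (le_trans (ler_normD _ _))// lerD// yz.
by rewrite distrC.
Qed.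

Lemma c1_along_zero_line (R : realType) (V : normedModType R) (v : V)
    (f : V -> R) (x : V) (h : R) :
  c1_along v f (fun=> 0) -> f (h *: v + x) = f x.
Proof.
move=> hf; wlog h0 : h x / 0 < h => [H|].
  have [h0|h0|->] := ltgtP h 0; last by rewrite scale0r add0r.
    by rewrite -(H (- h) (h *: v + x)) ?oppr_gt0// scaleNr addKr.
  exact: H.
have [s _ /eqP] := c1_along_MVT x hf h0.
by rewrite mulr0 subr_eq0 => /eqP.
Qed.

Lemma zero_partials_cst (R : realType) (m : nat) (f : 'rV[R]_m -> R) :
  (forall i, c1_along (delta_mx ord0 i) f (fun=> 0)) -> forall x, f x = f 0.
Proof.
move=> hf x.
(* Walk from 0 to [x] by switching on one coordinate at a time; each move is along a single basis
   vector. *)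
pose trunc k : 'rV[R]_m := \row_(i < m) (if (i < k)%N then x ord0 i else 0).
have -> : x = trunc m by apply/rowP => i; rewrite mxE ltn_ord.
suff H k : (k <= m)%N -> f (trunc k) = f 0 by exact: H.
elim: k => [_|k IH km]; first by congr f; apply/rowP => i; rewrite !mxE.
rewrite -(IH (ltnW km))
  -(c1_along_zero_line (trunc k) (x ord0 (Ordinal km)) (hf (Ordinal km))).
congr f; apply/rowP => i; rewrite !mxE /= ltnS leq_eqVlt.
have [->|ik] := eqVneq i (Ordinal km); first by rewrite /= !eqxx ltnn mulr1 addr0.
have /negPf ik' : (i : nat) != k by [].
by rewrite ik' mulr0 add0r.
Qed.

(** * Lattice sums *)

Section Lattice.
Variables (R : realType) (m : nat).
Implicit Types (Q M : nat).

Definition lattice_node Q M (k : {ffun 'I_m -> 'I_(2 * Q * M)}) : 'rV[R]_m :=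
  \row_(i < m) ((k i)%:R / M%:R - Q%:R).

(** The shift is cyclic, hence a bijection of the index set by which sums can be reindexed. *)
Definition lattice_shift N (i : 'I_m) (k : {ffun 'I_m -> 'I_N}) :
    {ffun 'I_m -> 'I_N} :=
  [ffun j => if j == i then ordS (k j) else k j].

Lemma lattice_shift_inj N i : injective (@lattice_shift N i).
Proof.
move=> k l /ffunP kl; apply/ffunP => j; have := kl j; rewrite !ffunE.
by case: eqP => // _ /(can_inj (@ordSK _)).
Qed.

Definition vanishes_outside_cube Q (f : 'rV[R]_m -> R) :=
  forall x : 'rV[R]_m, (exists j, Q%:R <= `|x ord0 j|) -> f x = 0.

(** Cyclic shift and translation differ only at the last index. There one point has [i]-th
    coordinate [-Q] and the other [Q], and [f] vanishes at both. *)
Lemma lattice_nodeS Q M i (k : {ffun 'I_m -> 'I_(2 * Q * M)}) f :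
  (0 < M)%N -> vanishes_outside_cube Q f ->
  f (lattice_node (lattice_shift i k)) =
  f (M%:R^-1 *: delta_mx ord0 i + lattice_node k).
Proof.
move=> M0 fQ; have M0' : M%:R != 0 :> R by rewrite pnatr_eq0 -lt0n.
have [kN|kN] := ltnP (k i).+1 (2 * Q * M).
  congr f; apply/rowP => j; rewrite !mxE !ffunE eqxx /=.
  case: eqP => [->|_]; last by rewrite mulr0 add0r.
  by rewrite /= modn_small// -natr1; field.
have kE : (k i).+1 = (2 * Q * M)%N by apply/eqP; rewrite eqn_leq kN ltn_ord.
rewrite !fQ//; exists i; rewrite !mxE ?ffunE !eqxx /=.
  have -> : (M%:R^-1 * 1 + ((k i)%:R / M%:R - Q%:R) : R) = Q%:R.
    have -> : (k i)%:R = 2 * Q%:R * M%:R - 1 :> R.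
      by apply/eqP; rewrite eq_sym subr_eq natr1 kE !natrM.
    by field.
  by rewrite ger0_norm.
by rewrite kE modnn mul0r sub0r normrN ger0_norm.
Qed.

Lemma norm_delta_mx_le1 (i : 'I_m) : `|delta_mx ord0 i : 'rV[R]_m| <= 1.
Proof.
rewrite [leLHS]mx_normrE; apply/bigmax_leP; split=> //= -[a b] _ /=.
by rewrite mxE; case: (_ && _); rewrite ?normr1 ?normr0.
Qed.

Lemma norm_lattice_node_le Q M (k : {ffun 'I_m -> 'I_(2 * Q * M)}) :
  (0 < M)%N -> `|lattice_node k| <= Q%:R.
Proof.
move=> M0; have M0' : 0 < M%:R :> R by rewrite ltr0n.
rewrite [leLHS]mx_normrE; apply/bigmax_leP; split=> //= -[a b] _ /=.
rewrite mxE ler_norml; apply/andP; split.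
  by rewrite lerBrDr addNr divr_ge0.
rewrite lerBlDr ler_pdivrMr// -natrD -natrM ler_nat addnn -mul2n.
exact: ltnW.
Qed.

Lemma compact_cube Q : compact [set x : 'rV[R]_m | `|x| <= Q%:R].
Proof.
apply: bounded_closed_compact.
  by exists Q%:R; split; [exact: num_real|move=> N QN x /= /le_trans; apply; exact: ltW].
apply: (@preimage_closed _ _ (fun x : 'rV[R]_m => `|x|) [set r : R | r <= Q%:R]);
  last exact: (@closed_le R Q%:R).
by move=> x _; exact: norm_continuous.
Qed.

(* Translation invariance makes the sum of the forward difference quotients
   vanish, and these are uniformly close to the derivative. *)
Lemma lattice_sum_derivative_small Q (i : 'I_m) f df (e : R) :
  c1_along (delta_mx ord0 i) f df -> vanishes_outside_cube Q f -> 0 < e ->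
  exists M0, forall M, (M0 < M)%N ->
    `|\sum_(k : {ffun 'I_m -> 'I_(2 * Q * M)}) df (lattice_node k)| <=
    e * (2 * Q * M)%:R ^+ m.
Proof.
move=> hf fQ e0; have [_ cdf _] := hf.
have [d d0 dP] := compact_uniform (@compact_cube Q) cdf e0.
exists (Num.truncn d^-1) => M /= dM.
have M0 : (0 < M)%N by rewrite (leq_ltn_trans _ dM).
have M0' : 0 < M%:R :> R by rewrite ltr0n.
have Md : M%:R^-1 < d.
  by rewrite invf_plt// -truncn_lt_nat// invr_ge0 ltW.
pose D k := M%:R * (f (M%:R^-1 *: delta_mx ord0 i + @lattice_node Q M k) -
  f (lattice_node k)).
have hk k : `|df (lattice_node k) - D k| <= e.
  have Mi : 0 < M%:R^-1 :> R by rewrite invr_gt0.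
  have [s /andP[s0 sM] E] := c1_along_MVT (lattice_node k) hf Mi.
  rewrite /D E mulrA mulfV ?gt_eqF// mul1r distrC.
  apply: dP; first exact: norm_lattice_node_le.
  rewrite addrK normrZ gtr0_norm// (le_lt_trans _ Md)//.
  by rewrite -[leRHS]mulr1 ler_pM ?norm_delta_mx_le1// ltW.
have S0 : \sum_k D k = 0.
  rewrite -mulr_sumr sumrB.
  under eq_bigr do rewrite -lattice_nodeS//.
  have /= <- := @reindex_inj _ _ _ _ _ xpredT
    (fun k => f (@lattice_node Q M k)) (@lattice_shift_inj _ i).
  by rewrite subrr mulr0.
have -> : \sum_k df (@lattice_node Q M k) = \sum_k (df (lattice_node k) - D k).
  by rewrite sumrB S0 subr0.
apply: (le_trans (ler_norm_sum _ _ _)).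
apply: (@le_trans _ _ (\sum_(k : {ffun 'I_m -> 'I_(2 * Q * M)}) e)).
  by apply: ler_sum => k _; exact: hk.
by rewrite sumr_const card_ffun !card_ord -[_ *+ _]mulr_natr natrX.
Qed.

(** A cube of side [1/l] contains at least [M^m] nodes of the lattice of mesh [1/(l M)]. *)
Lemma lattice_sum_ge (g : 'rV[R]_m -> R) (x0 : 'rV[R]_m) (c : R) Q l M :
  (0 < l)%N -> (0 < M)%N -> (forall x, 0 <= g x) -> 0 <= c ->
  `|x0| + 1 < Q%:R ->
  (forall x : 'rV[R]_m,
    (forall i, x0 ord0 i <= x ord0 i <= x0 ord0 i + l%:R^-1) -> c <= g x) ->
  c * M%:R ^+ m <=
  \sum_(k : {ffun 'I_m -> 'I_(2 * Q * (l * M))}) g (lattice_node k).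
Proof.
move=> l0 M0 g0 c0 x0Q gc.
have l0' : 0 < l%:R :> R by rewrite ltr0n.
have M0' : 0 < M%:R :> R by rewrite ltr0n.
have x0i i : `|x0 ord0 i| <= `|x0|.
  rewrite [leRHS]mx_normrE.
  exact: (@le_bigmax _ _ _ 0 (fun p : 'I_1 * 'I_m => `|x0 p.1 p.2|) (ord0, i)).
(* [y i] is the real-valued lattice index of the corner [x0]; the next [M] integers index nodes of
   the cube. *)
pose y i := (x0 ord0 i + Q%:R) * (l%:R * M%:R).
have y0 i : 0 <= y i.
  rewrite mulr_ge0 ?mulr_ge0//; have := x0i i; have := ler_norm (- x0 ord0 i).
  by rewrite normrN; lra.
have jN i (j : 'I_M) : ((Num.truncn (y i)).+1 + j < 2 * Q * (l * M))%N.
  rewrite -(ltr_nat R) addSnnS natrD.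
  have h1 : (Num.truncn (y i))%:R <= y i by rewrite truncn_le.
  have h2 : j.+1%:R <= M%:R :> R by rewrite ler_nat.
  apply: le_lt_trans (lerD h1 h2) _.
  have h3 : M%:R <= l%:R * M%:R :> R by rewrite ler_pMl// ler1n.
  apply: le_lt_trans (lerD (lexx _) h3) _.
  rewrite !natrM /y -[X in _ + X]mul1r -mulrDl ltr_pM2r ?mulr_gt0//.
  by have := x0i i; have := ler_norm (x0 ord0 i); lra.
pose F (k : {ffun 'I_m -> 'I_M}) : {ffun 'I_m -> 'I_(2 * Q * (l * M))} :=
  [ffun i => Ordinal (jN i (k i))].
have Finj : injective F.
  move=> k k' /ffunP kk'; apply/ffunP => i; have := kk' i.
  by rewrite !ffunE => /(congr1 val) /= /addnI /val_inj.
apply: (@le_trans _ _ (\sum_(k in F @: predT) g (lattice_node k))); last first.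
  by rewrite [leRHS](bigID (mem (F @: predT)))/= lerDl sumr_ge0.
rewrite big_imset/=; last by move=> ? ? _ _; exact: Finj.
apply: (@le_trans _ _ (\sum_(k in {: {ffun 'I_m -> 'I_M}}) c)).
  by rewrite sumr_const card_ffun !card_ord -[c *+ _]mulr_natr natrX.
apply: ler_sum => k _; apply: gc => i; rewrite mxE ffunE /=.
have h1 : (Num.truncn (y i))%:R <= y i by rewrite truncn_le.
have h2 : y i < (Num.truncn (y i)).+1%:R by exact: truncnS_gt.
have h3 : (k i).+1%:R <= M%:R :> R by rewrite ler_nat.
have lM : 0 < l%:R * M%:R :> R by rewrite mulr_gt0.
rewrite natrM lerBrDr lerBlDr; apply/andP; split.
  rewrite ler_pdivlMr// natrD (le_trans (ltW h2))// lerDl//.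
rewrite ler_pdivrMr// addSnnS natrD (le_trans (lerD h1 h3))//.
rewrite /y le_eqVlt; apply/orP; left; apply/eqP; field.
by rewrite gt_eqF.
Qed.

Lemma card_lattice_slab Q r M : (r <= Q)%N ->
  (#|[pred j : 'I_(2 * Q * M) | (`|j%:R / M%:R - Q%:R| <= r%:R :> R)%R]|
    <= (2 * r * M).+1)%N.
Proof.
move=> rQ; have [->|M0] := posnP M.
  by rewrite (leq_trans (max_card _))// card_ord muln0.
have M0' : 0 < M%:R :> R by rewrite ltr0n.
rewrite cardE -(size_map val) -(size_iota ((Q - r) * M) (2 * r * M).+1).
apply: uniq_leq_size; first by rewrite (map_inj_uniq val_inj) enum_uniq.
move=> _ /mapP[j + ->]; rewrite mem_enum inE ler_norml mem_iota.
rewrite lerBrDr lerBlDr ler_pdivlMr// ler_pdivrMr// addrC -natrB//.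
rewrite -natrD -!natrM !ler_nat => /andP[-> jr] /=.
rewrite addnS ltnS (leq_trans jr)// -mulnDl leq_mul2r; apply/orP; right.
by rewrite mul2n -addnn addnA subnK// addnC.
Qed.

(** At most [2 r M + 1 <= 3 r M] indices per axis fall in the inner cube, where [K] applies; all
    other nodes are charged to [e]. *)
Lemma lattice_sum_le (g : 'rV[R]_m -> R) (e K : R) Q r M :
  (0 < r <= Q)%N -> (0 < M)%N -> 0 <= e -> 0 <= K ->
  (forall x : 'rV[R]_m, (forall i, `|x ord0 i| <= r%:R) -> g x <= K) ->
  (forall (x : 'rV[R]_m) i, r%:R < `|x ord0 i| -> g x <= e) ->
  \sum_(k : {ffun 'I_m -> 'I_(2 * Q * M)}) g (lattice_node k) <=
  e * (2 * Q * M)%:R ^+ m + K * (3 * r * M)%:R ^+ m.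
Proof.
move=> /andP[r0 rQ] M0 e0 K0 gK ge.
pose P := [pred j : 'I_(2 * Q * M) | `|j%:R / M%:R - Q%:R| <= r%:R :> R].
apply: (@le_trans _ _ (\sum_(k : {ffun 'I_m -> 'I_(2 * Q * M)})
    (e + (if k \in ffun_on P then K else 0)))).
  apply: ler_sum => k _; case: ifPn => [/ffun_onP kP|/ffun_onP kP].
    apply: (@le_trans _ _ K); last by rewrite lerDr.
    by apply: gK => i; rewrite mxE; exact: kP.
  rewrite addr0; have [i] : exists i, ~ (k i \in P) by apply/existsNP.
  by move=> /negP; rewrite inE -ltNge => ki; apply: (ge _ i); rewrite mxE.
rewrite big_split /= sumr_const card_ffun !card_ord -[e *+ _]mulr_natr natrX.
rewrite lerD2l -big_mkcond /= sumr_const card_ffun_on card_ord -[K *+ _]mulr_natr.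
rewrite ler_wpM2l// natrX lerXn2r ?nnegrE// ler_nat.
apply: leq_trans (card_lattice_slab M rQ) _.
by rewrite -addn1 -!mulnA (mulSn 2) addnC leq_add2r muln_gt0 r0.
Qed.

End Lattice.

(** Sum the pointwise inequality over the lattice of mesh [1/(l M)] and divide by [(l M)^m]. The
    divergence contributes at most an arbitrary [d > 0] once [M] is large. *)
Lemma divergence_inequality_integrated (R : realType) (m : nat) (Q r l : nat)
    (g B : 'rV[R]_m -> R) (Z dZ : 'I_m -> 'rV[R]_m -> R) (x0 : 'rV[R]_m)
    (c e K : R) :
  (0 < l)%N -> (0 < r <= Q)%N -> 0 <= c -> 0 <= e -> 0 <= K ->
  `|x0| + 1 < Q%:R ->
  (forall i, c1_along (delta_mx ord0 i) (Z i) (dZ i)) ->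
  (forall i, vanishes_outside_cube Q (Z i)) ->
  (forall x, 0 <= g x) -> (forall x, g x <= \sum_i dZ i x + B x) ->
  (forall x : 'rV[R]_m,
    (forall i, x0 ord0 i <= x ord0 i <= x0 ord0 i + l%:R^-1) -> c <= g x) ->
  (forall x : 'rV[R]_m, (forall i, `|x ord0 i| <= r%:R) -> B x <= K) ->
  (forall (x : 'rV[R]_m) i, r%:R < `|x ord0 i| -> B x <= e) ->
  c * l%:R ^- m <= e * (2 * Q)%:R ^+ m + K * (3 * r)%:R ^+ m.
Proof.
move=> l0 rQ c0 e0 K0 x0Q hZ ZQ g0 gB gc BK Be.
apply/ler_addgt0Pl => d d0.
have Q0 : (0 < Q)%N by case/andP: rQ => r0; apply: leq_trans.
have Qm : 0 < (2 * Q)%:R ^+ m :> R by rewrite exprn_gt0// ltr0n muln_gt0.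
(* The [m] derivative sums share the budget [d]; [m.+1] keeps the denominator nonzero when
   [m = 0]. *)
pose e1 := d / (m.+1%:R * (2 * Q)%:R ^+ m).
have e10 : 0 < e1 by rewrite divr_gt0// mulr_gt0// ltr0n.
have [M0 M0P] := choice (fun i => lattice_sum_derivative_small (hZ i) (@ZQ i) e10).
pose M := (\max_i M0 i).+1; have Mpos : (0 < M)%N by [].
have lM0 : (0 < l * M)%N by rewrite muln_gt0 l0.
have lM : 0 < (l * M)%:R ^+ m :> R by rewrite exprn_gt0// ltr0n.
have ltM i : (M0 i < l * M)%N.
  by rewrite (@leq_trans M)// ?leq_pmull// ltnS leq_bigmax.
have lo := lattice_sum_ge l0 Mpos g0 c0 x0Q gc.
have hi := lattice_sum_le rQ lM0 e0 K0 BK Be.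
have mid : \sum_(k : {ffun 'I_m -> 'I_(2 * Q * (l * M))})
    \sum_i dZ i (lattice_node R k) <= d * (l * M)%:R ^+ m.
  rewrite exchange_big /=.
  apply: (@le_trans _ _ (\sum_(i < m) e1 * (2 * Q * (l * M))%:R ^+ m)).
    by apply: ler_sum => i _; apply: le_trans (ler_norm _) _; exact: M0P.
  rewrite sumr_const card_ord -[_ *+ m]mulr_natl natrM exprMn [e1 * _]mulrA mulrA.
  have -> : e1 * (2 * Q)%:R ^+ m = d / m.+1%:R.
    by rewrite /e1 invfM mulrA mulrVK// unitfE gt_eqF.
  apply: ler_wpM2r; first exact: ltW.
  by rewrite mulrCA ger_pMr// ler_pdivrMr ?ltr0n// mul1r ler_nat.
have all : c * M%:R ^+ m <= d * (l * M)%:R ^+ m +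
    (e * (2 * Q * (l * M))%:R ^+ m + K * (3 * r * (l * M))%:R ^+ m).
  apply: le_trans lo _; apply: le_trans (lerD mid hi); rewrite -big_split /=.
  by apply: ler_sum => k _.
rewrite -(ler_pM2r lM).
have -> : c * l%:R ^- m * (l * M)%:R ^+ m = c * M%:R ^+ m.
  by rewrite natrM exprMn mulrA divfK// expf_neq0// pnatr_eq0 -lt0n.
apply: le_trans all _; rewrite le_eqVlt; apply/orP; left; apply/eqP.
by rewrite (natrM _ (2 * Q)) (natrM _ (3 * r)) !exprMn; ring.
Qed.

(** * The divergence inequality on a minimal graph *)

Lemma coord_c1_along (R : realType) (m : nat) (i j : 'I_m) :
  c1_along (delta_mx ord0 i) (fun x : 'rV[R]_m => x ord0 j) (fun=> (j == i)%:R).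
Proof.
split=> x; [exact: coord_continuous|exact: cst_continuous|].
have -> : x = (0 : R) *: delta_mx ord0 i + x by rewrite scale0r add0r.
apply: (iffRL (is_derive_lineP _ _ _ _ _)).
apply: (@is_derive_quadratic_bound _ _ _ _ 0) => h.
rewrite [leRHS]mul0r normr_le0 !mxE /=; apply/eqP; ring.
Qed.

Lemma smooth_c1_along (R : realType) (m : nat) (u : 'rV[R]_m -> R) (i : 'I_m) :
  smooth u -> c1_along (delta_mx ord0 i) u (partial i u).
Proof.
move=> su; have [cu du] := su [::]; have [cdu _] := su [:: i].
by split=> // x; apply: derivableP; exact: du.
Qed.

Lemma smooth_partial (R : realType) (m : nat) (u : 'rV[R]_m -> R) (i : 'I_m) :
  smooth u -> smooth (partial i u).
Proof.
move=> su s; have := su (rcons s i).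
by rewrite /iter_partial -cats1 foldr_cat.
Qed.

(* With [a = p eta^3], [d = 3 delta eta^2] and [b = <x, grad u>] the right-hand
   side is the divergence of the contracted stress-energy tensor. *)
Lemma stress_energy_bound (R : realType) (n w a d q b : R) :
  0 <= n -> 1 <= w -> 0 <= a -> 0 <= d -> 1 <= q ->
  n * (w - 1) * (a / q ^+ 2 - d) <=
  - (n / q ^+ 2) * (a + d) * (w - 1) * (q ^+ 2 - 1) + (n + 2) * (a * (w - 1)) -
  - (n / q ^+ 2) * (a + d) * b ^+ 2 / w - a * (w ^+ 2 - 1) / w.
Proof.
move=> n0 w1 a0 d0 q1; rewrite -subr_ge0.
have w0 : 0 < w by exact: lt_le_trans w1.
have q0 : 0 < q by exact: lt_le_trans q1.
(* The difference of the two sides is a sum of nonnegative terms: the 2 in [n + 2] gives [2 (w - 1)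
   - (w^2 - 1) / w = (w - 1)^2 / w]. *)
rewrite [leRHS](_ : _ = (w - 1) * (n * d / q ^+ 2 + a * ((w - 1) / w)) +
    n * (a + d) * b ^+ 2 / (q ^+ 2 * w)); last by field; rewrite !gt_eqF.
have w10 : 0 <= w - 1 by rewrite subr_ge0.
have q20 : 0 <= (q ^+ 2)^-1 by rewrite invr_ge0 sqr_ge0.
have w20 : 0 <= w^-1 by rewrite invr_ge0 ltW.
apply: addr_ge0; last first.
  by rewrite invfM; do ![by []|apply: sqr_ge0|apply: mulr_ge0|apply: addr_ge0].
by rewrite mulr_ge0// addr_ge0// !mulr_ge0.
Qed.

Lemma sumr_sqr_ge0 (R : realDomainType) (I : finType) (P : pred I) (F : I -> R) :
  0 <= \sum_(i | P i) F i ^+ 2.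
Proof. by apply: sumr_ge0 => i _; exact: sqr_ge0. Qed.

Section Fields.
Variables (R : realType) (m n : nat).
Hypotheses (n_gt0 : (0 < n)%N) (mE : m = n.+2).
Implicit Types x : 'rV[R]_m.

Definition qnorm x : R := Num.sqrt (1 + \sum_(j < m) x ord0 j ^+ 2).

Lemma sqr_qnorm x : qnorm x ^+ 2 = 1 + \sum_(j < m) x ord0 j ^+ 2.
Proof.
by rewrite sqr_sqrtr// addr_ge0// sumr_sqr_ge0.
Qed.

Lemma qnorm_ge1 x : 1 <= qnorm x.
Proof.
rewrite -[leLHS]sqrtr1 ler_sqrt; last by rewrite addr_ge0// sumr_sqr_ge0.
by rewrite lerDl sumr_sqr_ge0.
Qed.

Lemma qnorm_gt0 x : 0 < qnorm x.
Proof. exact: lt_le_trans (qnorm_ge1 x). Qed.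

Lemma qnorm_c1_along i :
  c1_along (delta_mx ord0 i) qnorm (fun x => x ord0 i / qnorm x).
Proof.
have h := c1_alongD (c1_along_cst (delta_mx ord0 i : 'rV[R]_m) (1 : R))
  (c1_along_sum (fun j : 'I_m => c1_alongX 2 (coord_c1_along R i j))).
apply: c1_along_ext (c1_along_sqrt _ h) => x; last first.
  by rewrite ltr_pwDl// sumr_sqr_ge0.
rewrite -/(qnorm x) add0r (bigD1 i)//= big1 => [|j /negPf ->]; last by rewrite mulr0.
rewrite eqxx mulr1 addr0 expr1 invfM mulrACA mulVf ?pnatr_eq0// mul1r mulrC.
by [].
Qed.

(** * First derivatives of the area density and of the field [F] *)

Variables (u : 'rV[R]_m -> R).
Hypotheses (su : smooth u) (minu : entire_minimal_graph u).

Let du i := partial i u.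
Let ddu i j := partial i (partial j u).
Let W := area_density u.

Lemma area_densityE x : W x = Num.sqrt (1 + \sum_j du j x ^+ 2).
Proof.
rewrite /W /area_density /enorm sqr_sqrtr; last exact: sumr_sqr_ge0.
by congr (Num.sqrt (1 + _)); apply: eq_bigr => j _; rewrite mxE.
Qed.

Lemma sqr_area_density x : W x ^+ 2 = 1 + \sum_j du j x ^+ 2.
Proof.
by rewrite area_densityE sqr_sqrtr// addr_ge0// sumr_sqr_ge0.
Qed.

Lemma area_density_ge1 x : 1 <= W x.
Proof.
rewrite area_densityE -[leLHS]sqrtr1 ler_sqrt; last by rewrite addr_ge0// sumr_sqr_ge0.
by rewrite lerDl sumr_sqr_ge0.
Qed.

Let W_gt0 x : 0 < W x. Proof. exact: lt_le_trans (area_density_ge1 x). Qed.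
Let W_neq0 x : W x != 0. Proof. by rewrite gt_eqF. Qed.

Let dW i x := (W x)^-1 * \sum_j du j x * ddu i j x.

Lemma area_density_c1_along i : c1_along (delta_mx ord0 i) W (dW i).
Proof.
have h := c1_alongD (c1_along_cst (delta_mx ord0 i : 'rV[R]_m) (1 : R))
  (c1_along_sum (fun j : 'I_m => c1_alongX 2 (smooth_c1_along i (smooth_partial j su)))).
have -> : W = (fun x => Num.sqrt (1 + \sum_j du j x ^+ 2)).
  by apply/funext => x; exact: area_densityE.
apply: c1_along_ext (c1_along_sqrt _ h) => x; last first.
  by rewrite ltr_pwDl// sumr_sqr_ge0.
rewrite add0r /dW area_densityE invfM mulrAC mulr_sumr mulrC.
congr (_ * _); apply: eq_bigr => j _; rewrite expr1 mulrA mulrA mulVf ?mul1r//.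
Qed.

Let F i x := (W x)^-1 * du i x.
Let dF i j x := - (W x) ^- 2 * dW i x * du j x + (W x)^-1 * ddu i j x.

Lemma normal_c1_along i j : c1_along (delta_mx ord0 i) (F j) (dF i j).
Proof.
apply: c1_alongM; first exact: c1_alongV (area_density_c1_along i).
exact: smooth_c1_along (smooth_partial j su).
Qed.

Lemma minimal_graph_eq x : \sum_i dF i i x = 0.
Proof.
rewrite -[RHS](minu x) /divergence; apply: eq_bigr => i _.
have [_ _ /(_ x) /@derive_val <-] := normal_c1_along i i.
by congr ('D_ _ _ x); apply/funext => y; rewrite !mxE.
Qed.

Lemma second_partial_sym i j x : ddu i j x = ddu j i x.
Proof.
have hi := smooth_c1_along i su; have hj := smooth_c1_along j su.
have hij := smooth_c1_along i (smooth_partial j su).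
have hji := smooth_c1_along j (smooth_partial i su).
exact: (c1_along_symmetry x hj hij hi hji).
Qed.

(** * Radial cutoffs and the divergences of the two fields *)

Variables (c delta : R).

Let s x := 1 - delta * qnorm x ^+ n.
Let eta x := Num.max (s x) 0.
(* [eta] has gradient [- sigma x] wherever it is positive. *)
Let sigma x := delta * n%:R * qnorm x ^+ n / qnorm x ^+ 2.
Let p x := (qnorm x ^+ n)^-1.
(* This is [p eta^3], written so that only [eta ^+ 2], which is C^1, has to be
   differentiated; its gradient is [zeta x]. *)
Let phi x := p x * (eta x ^+ 2 * s x).
Let zeta x := - (n%:R / qnorm x ^+ 2) * (p x * eta x ^+ 3 + 3 * delta * eta x ^+ 2).
Let v x := u x - c.
Let b x := \sum_j x ord0 j * du j x.
Let db i x := du i x + \sum_j x ord0 j * ddu i j x.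

Let q_neq0 x : qnorm x != 0. Proof. by rewrite gt_eqF// qnorm_gt0. Qed.

Let qXn x : qnorm x ^+ n = qnorm x ^+ n.-1 * qnorm x.
Proof. by rewrite -exprSr prednK. Qed.

Let s_c1 i : c1_along (delta_mx ord0 i) s (fun x => - sigma x * x ord0 i).
Proof.
have h := c1_alongB (c1_along_cst (delta_mx ord0 i : 'rV[R]_m) (1 : R))
  (c1_alongM (c1_along_cst _ delta) (c1_alongX n (qnorm_c1_along i))).
apply: c1_along_ext h => x; rewrite /sigma qXn.
by move: (qnorm x ^+ n.-1) (q_neq0 x) => w q0; field.
Qed.

Let p_c1 i : c1_along (delta_mx ord0 i) p
  (fun x => - (n%:R * p x / qnorm x ^+ 2) * x ord0 i).
Proof.
have h := c1_alongV _ (c1_alongX n (qnorm_c1_along i)).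
apply: c1_along_ext (h _) => x; last by rewrite expf_neq0.
rewrite /p qXn; have := q_neq0 x; have : qnorm x ^+ n.-1 != 0 by rewrite expf_neq0.
by move: (qnorm x ^+ n.-1) => w w0 q0; field; rewrite w0 q0.
Qed.

Let eta_s x : eta x * s x = eta x ^+ 2.
Proof. by rewrite /eta; case: leP => _; rewrite ?mul0r ?expr0n. Qed.

Let eta2_c1 i : c1_along (delta_mx ord0 i) (fun x => eta x ^+ 2)
  (fun x => - (2 * eta x * sigma x) * x ord0 i).
Proof.
apply: c1_along_ext (c1_along_sqr_pos_part (s_c1 i)) => x.
by rewrite -/(eta x); ring.
Qed.

Let phi_c1 i : c1_along (delta_mx ord0 i) phi (fun x => zeta x * x ord0 i).
Proof.
apply: c1_along_ext (c1_alongM (p_c1 i) (c1_alongM (eta2_c1 i) (s_c1 i))) => x.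
(* The weight [p = q^-n] cancels the factor [q^n] of [sigma], so the term of [zeta] coming from the
   cutoff carries no [p]. *)
have pq : p x * sigma x = delta * n%:R / qnorm x ^+ 2.
  rewrite /p /sigma; have := q_neq0 x; have : qnorm x ^+ n != 0 by rewrite expf_neq0.
  by move: (qnorm x ^+ n) => w w0 q0; field; rewrite w0 q0.
have e1 := eta_s x.
have -> : eta x ^+ 2 * s x = eta x ^+ 3 by rewrite exprS -mulrA e1; ring.
have -> : - (2 * eta x * sigma x) * x ord0 i * s x =
  - (2 * sigma x * x ord0 i) * eta x ^+ 2 by rewrite -e1; ring.
transitivity ((- (n%:R * p x / qnorm x ^+ 2 * eta x ^+ 3) -
   3 * (p x * sigma x) * eta x ^+ 2) * x ord0 i); first by ring.
by rewrite pq /zeta; ring.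
Qed.

Let b_c1 i : c1_along (delta_mx ord0 i) b (db i).
Proof.
apply: c1_along_ext (c1_along_sum (fun j : 'I_m => c1_alongM (coord_c1_along R i j)
  (smooth_c1_along i (smooth_partial j su)))) => x.
rewrite big_split /=; congr (_ + _).
rewrite (bigD1 i)//= eqxx mul1r big1 ?addr0// => j /negPf ->.
by rewrite mul0r.
Qed.

Let v_c1 i : c1_along (delta_mx ord0 i) v (du i).
Proof.
apply: c1_along_ext (c1_alongB (smooth_c1_along i su) (c1_along_cst _ c)) => x.
by rewrite subr0.
Qed.

(** The tensor [(W - 1) Id - F (x) grad u] applied to the radial field [phi x]. *)
Let Y i x := phi x * (W x - 1) * x ord0 i - phi x * b x * F i x.
Let dY i x := zeta x * (W x - 1) * x ord0 i ^+ 2 + phi x * (x ord0 i * dW i x) +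
  phi x * (W x - 1) - zeta x * b x / W x * (x ord0 i * du i x) -
  phi x / W x * (du i x ^+ 2) -
  phi x / W x * (du i x * \sum_j x ord0 j * ddu i j x) - phi x * b x * dF i i x.

Let Y_c1 i : c1_along (delta_mx ord0 i) (Y i) (dY i).
Proof.
have h := c1_alongB
  (c1_alongM (c1_alongM (phi_c1 i) (c1_alongB (area_density_c1_along i)
    (c1_along_cst _ (1 : R)))) (coord_c1_along R i i))
  (c1_alongM (c1_alongM (phi_c1 i) (b_c1 i)) (normal_c1_along i i)).
apply: c1_along_ext h => x; rewrite eqxx mulr1 /dY /db /F.
by move: (\sum_j _ * _) (dF i i x) (dW i x) => ? ? ?; ring.
Qed.

(** This is where the Hessian of [u] must be symmetric. It cancels the second-order terms of
    [div Y], apart from [div F], which is zero: the conservation law of the stress-energy tensor. *)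
Let sum_x_dW x : \sum_i x ord0 i * dW i x =
  (W x)^-1 * \sum_i du i x * \sum_j x ord0 j * ddu i j x.
Proof.
rewrite /dW; under eq_bigr do rewrite mulrCA.
rewrite -mulr_sumr; congr (_ * _).
under eq_bigr do rewrite mulr_sumr.
rewrite exchange_big /=; apply: eq_bigr => i _; rewrite mulr_sumr.
by apply: eq_bigr => j _; rewrite second_partial_sym mulrCA.
Qed.

Let sum_dY x : \sum_i dY i x = zeta x * (W x - 1) * (qnorm x ^+ 2 - 1) +
  m%:R * (phi x * (W x - 1)) - zeta x * b x ^+ 2 / W x -
  phi x * (W x ^+ 2 - 1) / W x.
Proof.
rewrite /dY !sumrB !big_split /= -!mulr_sumr sum_x_dW minimal_graph_eq.
rewrite sumr_const card_ord -/(b x) sqr_qnorm sqr_area_density mulr_natl.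
by ring.
Qed.

Let X i x := eta x ^+ 2 * v x * F i x.
Let dX i x := - (2 * eta x * sigma x * v x / W x) * (x ord0 i * du i x) +
  eta x ^+ 2 / W x * du i x ^+ 2 + eta x ^+ 2 * v x * dF i i x.

Let X_c1 i : c1_along (delta_mx ord0 i) (X i) (dX i).
Proof.
have h := c1_alongM (c1_alongM (eta2_c1 i) (v_c1 i)) (normal_c1_along i i).
by apply: c1_along_ext h => x; rewrite /dX /F; move: (dF i i x) => ?; ring.
Qed.

Let sum_dX x : \sum_i dX i x = - (2 * eta x * sigma x * v x * b x / W x) +
  eta x ^+ 2 * (W x ^+ 2 - 1) / W x.
Proof.
rewrite /dX !big_split /= -!mulr_sumr minimal_graph_eq -/(b x) sqr_area_density.
by ring.
Qed.

(** * Caccioppoli estimate and the combined divergence inequality *)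

Variable Q : nat.
Hypotheses (Q_gt0 : (0 < Q)%N) (deltaE : delta = Q%:R ^- n).

Let delta_gt0 : 0 < delta.
Proof. by rewrite deltaE invr_gt0 exprn_gt0// ltr0n. Qed.

Let eta_ge0 x : 0 <= eta x. Proof. by rewrite /eta le_max lexx orbT. Qed.

Let p_ge0 x : 0 <= p x.
Proof. by rewrite invr_ge0 exprn_ge0// ltW// qnorm_gt0. Qed.

Let QR_gt0 : 0 < Q%:R :> R. Proof. by rewrite ltr0n. Qed.

Let delta_qXn x : delta * qnorm x ^+ n = (qnorm x / Q%:R) ^+ n.
Proof. by rewrite deltaE exprMn exprVn mulrC. Qed.

Let eta_eq0 x : Q%:R <= qnorm x -> eta x = 0.
Proof.
move=> Qq; apply/max_idPr; rewrite subr_le0 delta_qXn exprn_ege1//.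
by rewrite ler_pdivlMr// mul1r.
Qed.

(** Since [q^2 - 1 = |x|^2], this bounds [|grad eta|^2]. With [r = q / Q <= 1] one has
    [sigma = n r^n / q^2], and [r^n <= r] because [n > 0]. *)
Let sigma_bound x : eta x != 0 ->
  sigma x ^+ 2 * (qnorm x ^+ 2 - 1) <= n%:R ^+ 2 / Q%:R ^+ 2.
Proof.
move=> eta0; have q0 := qnorm_gt0 x.
have qQ : qnorm x <= Q%:R.
  by rewrite leNgt; apply: contra eta0 => /ltW /eta_eq0 ->.
pose r := qnorm x / Q%:R.
have r0 : 0 <= r by rewrite divr_ge0 ?ltW.
have r1 : r <= 1 by rewrite ler_pdivrMr// mul1r.
have -> : sigma x = n%:R * r ^+ n / qnorm x ^+ 2.
  by rewrite -delta_qXn /sigma; ring.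
have -> : (n%:R * r ^+ n / qnorm x ^+ 2) ^+ 2 * (qnorm x ^+ 2 - 1) =
  n%:R ^+ 2 * ((r ^+ n) ^+ 2 / qnorm x ^+ 2 * (1 - (qnorm x ^+ 2)^-1)).
  by move: (r ^+ n) => rn; field; rewrite gt_eqF.
rewrite ler_wpM2l ?sqr_ge0//.
have -> : (Q%:R ^+ 2)^-1 = r ^+ 2 / qnorm x ^+ 2.
  by rewrite /r; field; rewrite !gt_eqF.
rewrite -[leRHS]mulr1; apply: ler_pM.
- by rewrite divr_ge0 ?sqr_ge0.
- by rewrite subr_ge0 invf_le1 ?exprn_gt0// exprn_ege1// qnorm_ge1.
- rewrite ler_wpM2r ?invr_ge0 ?sqr_ge0// lerXn2r ?nnegrE ?exprn_ge0//.
  by rewrite ler_iXnr.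
- by rewrite gerBl invr_ge0 sqr_ge0.
Qed.

(** Complete the square in each coordinate, then apply [sigma_bound]; where [eta] is zero the left
    side vanishes. *)
Let young_bound x : 4 * eta x * sigma x * v x * b x <=
  eta x ^+ 2 * (W x ^+ 2 - 1) + 4 * (n%:R ^+ 2 / Q%:R ^+ 2) * v x ^+ 2.
Proof.
have [->|eta0] := eqVneq (eta x) 0.
  rewrite expr0n /= !(mulr0, mul0r) add0r.
  by do ![by []|apply: sqr_ge0|apply: divr_ge0|apply: mulr_ge0].
apply: (@le_trans _ _ (eta x ^+ 2 * (W x ^+ 2 - 1) +
    4 * (sigma x ^+ 2 * (qnorm x ^+ 2 - 1)) * v x ^+ 2)); last first.
  by rewrite lerD2l ler_wpM2r ?sqr_ge0// ler_wpM2l// sigma_bound.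
have -> : W x ^+ 2 - 1 = \sum_i du i x ^+ 2 by rewrite sqr_area_density; ring.
have -> : qnorm x ^+ 2 - 1 = \sum_i x ord0 i ^+ 2 by rewrite sqr_qnorm; ring.
rewrite [leRHS](_ : _ = \sum_i (eta x ^+ 2 * du i x ^+ 2 +
    4 * sigma x ^+ 2 * v x ^+ 2 * x ord0 i ^+ 2)); last first.
  by rewrite big_split /= -!mulr_sumr; ring.
rewrite /b mulr_sumr.
apply: ler_sum => i _; rewrite -subr_ge0.
rewrite [leRHS](_ : _ = (eta x * du i x - 2 * sigma x * v x * x ord0 i) ^+ 2);
  last by ring.
exact: sqr_ge0.
Qed.

(** The error [3 n delta eta^2 (W - 1)] left by [Y] is absorbed by [3 n delta] times the Caccioppoli
    inequality, in which [div X] has coefficient 2. *)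
Let Z i x := Y i x + 6 * n%:R * delta * X i x.
Let dZ i x := dY i x + 6 * n%:R * delta * dX i x.

Let Z_c1 i : c1_along (delta_mx ord0 i) (Z i) (dZ i).
Proof.
apply: c1_along_ext (c1_alongD (Y_c1 i) (c1_alongM (c1_along_cst _ _) (X_c1 i))) => x.
by rewrite mul0r add0r.
Qed.

Let Z_vanish i : vanishes_outside_cube Q (Z i).
Proof.
move=> x [j Qx]; have Qq : Q%:R <= qnorm x.
  apply: le_trans Qx _; rewrite -sqrtr_sqr ler_sqrt; last first.
    by rewrite addr_ge0// sumr_sqr_ge0.
  by rewrite (bigD1 j)//= addrCA lerDl addr_ge0// sumr_sqr_ge0.
by rewrite /Z /Y /X /phi eta_eq0// expr0n /= !(mul0r, mulr0) subr0 addr0.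
Qed.

Let Z_bound x :
  n%:R * (W x - 1) * (p x * eta x ^+ 3 / qnorm x ^+ 2) <=
  \sum_i dZ i x + 12 * n%:R ^+ 3 * Q%:R ^- m * (v x ^+ 2 / W x).
Proof.
have w1 := area_density_ge1 x; have w0 := W_gt0 x.
have phiE : phi x = p x * eta x ^+ 3.
  by rewrite /phi [eta x ^+ 3]exprS exprS expr1 -[eta x ^+ 2 * s x]mulrA eta_s; ring.
have phi0 : 0 <= phi x by rewrite phiE mulr_ge0// exprn_ge0.
have d0 : 0 <= 3 * delta * eta x ^+ 2.
  by rewrite mulr_ge0 ?sqr_ge0// mulr_ge0// ltW.
have h1 := stress_energy_bound (b x) (ler0n R n) w1 phi0 d0 (qnorm_ge1 x).
have dYE : \sum_i dY i x = - (n%:R / qnorm x ^+ 2) * (phi x + 3 * delta * eta x ^+ 2) *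
   (W x - 1) * (qnorm x ^+ 2 - 1) + (n%:R + 2) * (phi x * (W x - 1)) -
  - (n%:R / qnorm x ^+ 2) * (phi x + 3 * delta * eta x ^+ 2) * b x ^+ 2 / W x -
  phi x * (W x ^+ 2 - 1) / W x.
  rewrite sum_dY /zeta -phiE; have -> : m%:R = n%:R + 2 :> R by rewrite mE -addn2 natrD.
  by [].
rewrite -dYE in h1.
(* Of the two copies of [eta^2 (W^2 - 1) / W] in [2 div X], one absorbs the cross term by
   [young_bound] and the other dominates the left side. *)
have h2 : eta x ^+ 2 * (W x - 1) <=
    2 * (\sum_i dX i x) + 4 * (n%:R ^+ 2 / Q%:R ^+ 2) * (v x ^+ 2 / W x).
  apply: (@le_trans _ _ (eta x ^+ 2 * (W x ^+ 2 - 1) / W x)).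
    rewrite -mulrA ler_wpM2l ?sqr_ge0// ler_pdivlMr//.
    have -> : W x ^+ 2 - 1 = (W x - 1) * (W x + 1) by ring.
    by rewrite ler_wpM2l ?subr_ge0// lerDl.
  rewrite sum_dX -subr_ge0.
  rewrite [leRHS](_ : _ = (eta x ^+ 2 * (W x ^+ 2 - 1) +
      4 * (n%:R ^+ 2 / Q%:R ^+ 2) * v x ^+ 2 -
      4 * eta x * sigma x * v x * b x) / W x); last by ring.
  by rewrite divr_ge0 ?subr_ge0 ?young_bound// ltW.
have nd0 : 0 <= 3 * n%:R * delta by apply: mulr_ge0; [exact: mulr_ge0|exact: ltW].
have {h2} := ler_wpM2l nd0 h2.
(* The factors [Q^-n] of [delta] and [Q^-2] of the cutoff gradient combine to [Q^-m], which balances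
   the volume of the cube. *)
have -> : Q%:R ^- m = delta / Q%:R ^+ 2 :> R.
  by rewrite deltaE mE -addn2 exprD invfM.
have -> : \sum_i dZ i x = \sum_i dY i x + 6 * n%:R * delta * \sum_i dX i x.
  by rewrite [X in _ = _ + X]mulr_sumr -big_split.
rewrite -phiE => h2.
apply: le_trans (_ : n%:R * (W x - 1) * (phi x / qnorm x ^+ 2) <= _) => //.
have := lerD h1 h2; rewrite -subr_ge0 => h; rewrite -subr_ge0.
by apply: le_trans h _; rewrite le_eqVlt; apply/orP; left; apply/eqP; ring.
Qed.

Lemma stress_energy_field : exists Z0 dZ0 : 'I_m -> 'rV[R]_m -> R,
  [/\ forall i, c1_along (delta_mx ord0 i) (Z0 i) (dZ0 i),
      forall i, vanishes_outside_cube Q (Z0 i) &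
      forall x, n%:R * (area_density u x - 1) * ((qnorm x ^+ n)^-1 *
          Num.max (1 - (qnorm x / Q%:R) ^+ n) 0 ^+ 3 / qnorm x ^+ 2) <=
        \sum_i dZ0 i x +
        12 * n%:R ^+ 3 * Q%:R ^- m * ((u x - c) ^+ 2 / area_density u x)].
Proof.
exists Z, dZ; split=> // x; rewrite -delta_qXn; exact: Z_bound.
Qed.

End Fields.

(** * Vanishing of the area excess *)

Lemma vanishing_at_infinity_of_sphere_max (R : realType) (m : nat)
    (f : 'rV[R]_m -> R) (e : R) :
  (0 < m)%N -> continuous f -> sphere_max f r @[r --> +oo%R] --> (0 : R) ->
  0 < e -> exists r : nat, forall x, r%:R < enorm x -> f x <= e.
Proof.
move=> m0 cf /cvgrPdist_le flim e0; have [M [_ MP]] := flim e e0.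
exists (Num.truncn M).+1 => x rx.
have x0 : 0 <= enorm x by rewrite sqrtr_ge0.
have Mx : M < enorm x by apply: lt_trans rx; exact: truncnS_gt.
(* Attainment is what makes the [sup] in [sphere_max] an actual upper bound for [f x]. *)
have [y [_ fy fxy]] := sphere_max_attained m0 x0 cf.
apply: le_trans (fxy x erefl) _; rewrite -fy.
by have := MP _ Mx; rewrite sub0r normrN; apply: le_trans; exact: ler_norm.
Qed.

Lemma continuous_bounded_cube (R : realType) (m : nat) (f : 'rV[R]_m -> R)
    (r : nat) : continuous f ->
  exists2 K, 0 <= K & forall x : 'rV[R]_m, (forall i, `|x ord0 i| <= r%:R) -> f x <= K.
Proof.
move=> cf.
have cube0 : [set x : 'rV[R]_m | `|x| <= r%:R] !=set0.
  by exists 0; rewrite /= normr0.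
have [x0 _ fmax] := EVT_max_rV cube0 (@compact_cube R m r) (continuous_subspaceT cf).
exists `|f x0| => // x xr; apply: le_trans (ler_norm _).
apply: fmax; rewrite inE /= [leLHS]mx_normrE; apply/bigmax_leP; split=> //= -[i j] _.
by rewrite ord1; exact: xr.
Qed.

Lemma area_density_eq1 (R : realType) (m n : nat) (u : 'rV[R]_m -> R) (c : R) :
  (0 < n)%N -> m = n.+2 -> smooth u -> entire_minimal_graph u ->
  sphere_max (fun x => (u x - c) ^+ 2 / area_density u x) r
    @[r --> +oo%R] --> (0 : R) ->
  forall x, area_density u x = 1.
Proof.
move=> n0 mE su minu flim x0; apply/eqP; apply: contraT => W1.
have W x : 1 <= area_density u x := area_density_ge1 u x.
have m0 : (0 < m)%N by rewrite mE.
have cW := area_density_c1_along su (Ordinal m0).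
have cq := qnorm_c1_along R (Ordinal m0).
have Wn0 x : area_density u x != 0 by rewrite gt_eqF// (lt_le_trans _ (W x)).
pose f x := (u x - c) ^+ 2 / area_density u x.
have [cf _ _] : c1_along _ f _ := c1_alongM (c1_alongX 2 (c1_alongB
  (smooth_c1_along (Ordinal m0) su) (c1_along_cst _ c))) (c1_alongV Wn0 cW).
(* The left-hand integrand without its cutoff: it does not depend on [Q], and it is positive at [x0]
   if [W x0] differs from 1. *)
pose g0 x := n%:R * (area_density u x - 1) * ((qnorm x ^+ n)^-1 / qnorm x ^+ 2).
have qX0 k (x : 'rV[R]_m) : qnorm x ^+ k != 0.
  by rewrite expf_neq0// gt_eqF// qnorm_gt0.
have [cg0 _ _] : c1_along _ g0 _ := c1_alongM
  (c1_alongM (c1_along_cst _ n%:R) (c1_alongB cW (c1_along_cst _ 1)))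
  (c1_alongM (c1_alongV (qX0 n) (c1_alongX n cq)) (c1_alongV (qX0 2) (c1_alongX 2 cq))).
have {cq} [cq _ _] := cq.
have g00 : 0 < g0 x0.
  rewrite /g0 !mulr_gt0 ?invr_gt0 ?exprn_gt0 ?qnorm_gt0 ?ltr0n//.
  by rewrite subr_gt0 lt_neqAle eq_sym W1 W.
have [l l0 lP] : exists2 l : nat, (0 < l)%N & forall x : 'rV[R]_m,
    (forall i, x0 ord0 i <= x ord0 i <= x0 ord0 i + l%:R^-1) ->
    g0 x0 / 2 <= g0 x /\ qnorm x <= qnorm x0 + 1.
  have g02 : 0 < g0 x0 / 2 by rewrite divr_gt0.
  have /cvgrPdist_le/(_ _ g02)/nbhs_normP[d1 /= d10 H1] := cg0 x0.
  have /cvgrPdist_le/(_ _ ltr01)/nbhs_normP[d2 /= d20 H2] := cq x0.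
  pose d := Num.min d1 d2; have d0 : 0 < d by rewrite lt_min d10.
  exists (Num.truncn d^-1).+1 => // x xx0.
  have xd : `|x0 - x| < d.
    apply: le_lt_trans (_ : (Num.truncn d^-1).+1%:R^-1 < d); last first.
      by rewrite invf_plt ?posrE// truncnS_gt.
    rewrite [leLHS]mx_normrE; apply/bigmax_leP; split=> [|[i j] _] /=.
      by rewrite invr_ge0.
    rewrite !mxE ord1 distrC ger0_norm; have /andP[h1 h2] := xx0 j.
      by rewrite lerBlDl.
    by rewrite subr_ge0.
  move: xd; rewrite lt_min => /andP[/H1 h1 /H2 h2].
  split; last by have := ler_norm (qnorm x - qnorm x0); rewrite distrC; lra.
  by have := ler_norm (g0 x0 - g0 x); lra.
pose C : R := 12 * n%:R ^+ 3.
have C0 : 0 < C by rewrite mulr_gt0// exprn_gt0// ltr0n.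
(* On the small cube [g0 >= g0 x0 / 2], and the cubed cutoff is at least [1/8] for large [Q]; hence
   the 16. *)
pose a := g0 x0 / 16 * l%:R ^- m.
have lm0 : 0 < l%:R ^- m :> R by rewrite invr_gt0 exprn_gt0// ltr0n.
have a0 : 0 < a by rewrite mulr_gt0// divr_gt0.
(* Chosen so that the far region contributes [C Q^-m e (2 Q)^m = a / 4], whatever [Q] is. *)
pose e := a / (4 * C * 2 ^+ m).
have p2 : 0 < 2 ^+ m :> R by rewrite exprn_gt0.
have e0 : 0 < e by rewrite divr_gt0// mulr_gt0// mulr_gt0.
have [r rP] := vanishing_at_infinity_of_sphere_max m0 cf flim e0.
have [K K0 KP] := continuous_bounded_cube r.+1 cf.
pose T := C * K * (3 * r.+1)%:R ^+ m.
have T0 : 0 <= T by rewrite mulr_ge0 ?mulr_ge0 ?exprn_ge0// ltW.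
(* The summands ensure, in order: cutoff at least [1/2] near [x0], the small cube inside the large
   one, [r.+1 <= Q], and a near-region contribution [T Q^-m <= T / Q <= a / 4]. The outcome is
   [a <= a / 4 + a / 4], impossible for [a > 0]. *)
have [Q Qpos QP] : exists2 Q : nat, (0 < Q)%N &
    2 * (qnorm x0 + 1) + (`|x0| + 1) + r.+1%:R + 4 * T / a < Q%:R.
  exists (Num.truncn (2 * (qnorm x0 + 1) + (`|x0| + 1) + r.+1%:R + 4 * T / a)).+1 => //.
  exact: truncnS_gt.
have q0 : 0 < qnorm x0 := qnorm_gt0 x0.
have Ta : 0 <= 4 * T / a.
  by apply: divr_ge0; [exact: mulr_ge0|exact: ltW].
have x0n := normr_ge0 x0; have r0 : 0 <= r.+1%:R :> R by [].
have Q0 : 0 < Q%:R :> R by rewrite ltr0n.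
have Qm : 0 < Q%:R ^- m :> R by rewrite invr_gt0 exprn_gt0.
have rQ : (0 < r.+1 <= Q)%N by apply/andP; split=> //; rewrite -(ler_nat R); lra.
have [Z [dZ [hZ ZQ ZP]]] := stress_energy_field n0 mE su minu c Qpos
  (erefl (Q%:R ^- n : R)).
have Cm0 : 0 < C * Q%:R ^- m by rewrite mulr_gt0.
pose g x := n%:R * (area_density u x - 1) * ((qnorm x ^+ n)^-1 *
  Num.max (1 - (qnorm x / Q%:R) ^+ n) 0 ^+ 3 / qnorm x ^+ 2).
have gE x : g x = g0 x * Num.max (1 - (qnorm x / Q%:R) ^+ n) 0 ^+ 3.
  by rewrite /g /g0; move: (Num.max _ _) => y; ring.
have g0_ge0 x : 0 <= g0 x.
  by rewrite !mulr_ge0 ?subr_ge0// invr_ge0 exprn_ge0// ltW// qnorm_gt0.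
have g_ge0 x : 0 <= g x by rewrite gE mulr_ge0// exprn_ge0// le_max lexx orbT.
have g_ge (x : 'rV[R]_m) :
    (forall i, x0 ord0 i <= x ord0 i <= x0 ord0 i + l%:R^-1) -> g0 x0 / 16 <= g x.
  move=> /lP[h1 h2].
  have qx0 := qnorm_gt0 x.
  have qQ0 : 0 <= qnorm x / Q%:R by rewrite divr_ge0 ?ltW.
  have qQ : qnorm x / Q%:R <= 2^-1.
    by rewrite ler_pdivrMr// ler_pdivlMl//; lra.
  have qQn : (qnorm x / Q%:R) ^+ n <= 2^-1.
    by apply: le_trans (qQ); apply: ler_iXnr => //; apply: le_trans (qQ) _; lra.
  have h3 : 2^-1 <= Num.max (1 - (qnorm x / Q%:R) ^+ n) 0.
    by rewrite le_max; apply/orP; left; lra.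
  have h4 : 2^-1 ^+ 3 <= Num.max (1 - (qnorm x / Q%:R) ^+ n) 0 ^+ 3.
    by rewrite lerXn2r ?nnegrE// (le_trans _ h3).
  rewrite gE (_ : g0 x0 / 16 = g0 x0 / 2 * 2^-1 ^+ 3); last by field.
  by rewrite ler_pM// ?exprn_ge0// divr_ge0// ltW.
have := @divergence_inequality_integrated R m Q r.+1 l g
  (fun x => C * Q%:R ^- m * f x) Z dZ x0 (g0 x0 / 16) (C * Q%:R ^- m * e)
  (C * Q%:R ^- m * K) l0 rQ (divr_ge0 (ltW g00) (ler0n _ _))
  (mulr_ge0 (ltW Cm0) (ltW e0)) (mulr_ge0 (ltW Cm0) K0) _ hZ ZQ g_ge0 ZP g_ge.
rewrite -/a => main.
have {main} : a <= C * Q%:R ^- m * e * (2 * Q)%:R ^+ m +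
    C * Q%:R ^- m * K * (3 * r.+1)%:R ^+ m.
  apply: main; first by lra.
    by move=> x xr; apply: ler_wpM2l; [exact: ltW|exact: KP].
  move=> x i xi; apply: ler_wpM2l; [exact: ltW|apply: rP].
  apply: lt_le_trans (coord_le_enorm x i); apply: le_lt_trans xi.
  by rewrite ler_nat.
have -> : C * Q%:R ^- m * e * (2 * Q)%:R ^+ m = a / 4.
  rewrite natrM exprMn /e; have Qm0 : Q%:R ^+ m != 0 :> R by rewrite expf_neq0// gt_eqF.
  move: (Q%:R ^+ m) Qm0 (2 ^+ m) p2 => y y0 z z0.
  by field; rewrite y0 !gt_eqF.
have -> : C * Q%:R ^- m * K * (3 * r.+1)%:R ^+ m = T * Q%:R ^- m by rewrite /T; ring.
have : T * Q%:R ^- m <= a / 4.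
  apply: (@le_trans _ _ (T / Q%:R)).
    by rewrite ler_wpM2l// lef_pV2 ?posrE ?exprn_gt0// ler_eXnr// ler1n.
  rewrite ler_pdivrMr// mulrAC ler_pdivlMr// mulrC -ler_pdivrMl// mulrC; lra.
lra.
Qed.

Lemma area_density_eq1_cst (R : realType) (m : nat) (u : 'rV[R]_m -> R) :
  smooth u -> (forall x, area_density u x = 1) -> forall x, u x = u 0.
Proof.
move=> su W1; apply: zero_partials_cst => i.
apply: c1_along_ext (smooth_c1_along i su) => x.
have := sqr_area_density u x; rewrite W1 expr1n -[LHS]addr0 => /addrI/esym/eqP.
rewrite psumr_eq0 => [/allP/(_ i)|j _]; last exact: sqr_ge0.
by rewrite mem_index_enum sqrf_eq0 => /(_ isT)/eqP.
Qed.

Theorem corollary6p2 (R : realType) (m : nat) (hm : (2 < m)%N)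
    (u : 'rV[R]_m -> R) (hsmooth : smooth u)
    (hmin : entire_minimal_graph u)
    (hlim : exists c : R,
      sphere_max (fun x : 'rV[R]_m => (u x - c) ^+ 2 / area_density u x) r
        @[r --> +oo%R] --> (0 : R)) :
  exists a : R, forall x : 'rV[R]_m, u x = a.
Proof.
case: hlim => c flim; exists (u 0); apply: area_density_eq1_cst => //.
have n0 : (0 < m - 2)%N by rewrite subn_gt0.
have mE : m = (m - 2).+2 by rewrite -addn2 subnK// ltnW.
exact: area_density_eq1 n0 mE hsmooth hmin flim.
Qed.
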